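(* Let $\overline{\Omega}_2$ denote the closure of $\Omega_2$ inside $\Sigma_2\times\Sigma_2^*$. The action of the Thompson group $F$ on $\Omega_2$ has a unique extension to an action of $F$ on $\overline{\Omega}_2$ by homeomorphisms.
   Context: Let $\mathcal{O}_2$ be the Cuntz algebra, the unital $C^*$-algebra generated by two isometries $S_1,S_2$ with $S_1S_1^*+S_2S_2^*=1$. Let $W_2$ be the set of all finite words (including the empty word $\emptyset$) in the alphabet $\{1,2\}$, and let $|\mu|$ be the length of $\mu\in W_2$. For $\mu=\mu_1\cdots\mu_k\in W_2$ put $S_\mu=S_{\mu_1}\cdots S_{\mu_k}$ (with $S_\emptyset=1$) and $P_\mu=S_\mu S_\mu^*$. Let $\mathcal{D}_2$ be the $C^*$-subalgebra of $\mathcal{O}_2$ generated by the projections $P_\mu$, $\mu\in W_2$ (it is commutative). The Thompson group $F$ is realized as the group of all unitaries in $\mathcal{O}_2$ of the form $f=\sum_{(\alpha,\beta)\in\mathcal{J}}S_\alpha S_\beta^*$, where $\mathcal{J}\subseteq W_2\times W_2$ is a finite set which is the graph of a bijection between its set of first coordinates $\mathcal{J}_1$ and its set of second coordinates $\mathcal{J}_2$, with $\sum_{\alpha\in\mathcal{J}_1}P_\alpha=1=\sum_{\beta\in\mathcal{J}_2}P_\beta$, and which is order preserving: for $(\alpha,\beta),(\alpha',\beta')\in\mathcal{J}$, $\alpha$ precedes $\alpha'$ in the lexicographic order if and only if $\beta$ precedes $\beta'$. For $f=\sum_{(\alpha,\beta)\in\mathcal{J}}S_\alpha S_\beta^*\in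 F$ put $$f_0=\sum_{(\alpha,\beta)\in\mathcal{J},\ |\alpha|-|\beta|\in 2\mathbb{Z}}S_\alpha S_\beta^*,\qquad f_1=\sum_{(\alpha,\beta)\in\mathcal{J},\ |\alpha|-|\beta|\notin 2\mathbb{Z}}S_\alpha S_\beta^*$$ (these do not depend on the chosen presentation of $f$). Define $\Omega_2=\{f_0f_0^*\mid f\in F\}$, a set of projections in $\mathcal{D}_2$. The group $F$ acts on $\Omega_2$ by $f\cdot p=f_0pf_0^*+f_1(1-p)f_1^*$. Let $\mathfrak{T}_2$ be the infinite binary rooted tree with vertices labeled by $W_2$, where the root is $\emptyset$ and the successors of $\alpha$ are $\alpha1$ and $\alpha2$. Let $\Sigma_2$ be the collection of all subtrees of $\mathfrak{T}_2$ containing the root and having no leaves, i.e. if a vertex $\alpha$ belongs to the subtree then at least one of its two successors does. Let $\Sigma_2^*$ be $\Sigma_2$ together with the empty tree. Identifying a subtree with its vertex set, $\Sigma_2^*\subseteq\{0,1\}^{W_2}$ carries the product topology (it is compact and metrizable): $\omega_n\to\omega$ if and only if for each $\alpha\in W_2$, one has $\alpha\in\omega\Leftrightarrow\alpha\in\omega_n$ for all sufficiently large $n$. Each projection $q\in\mathcal{D}_2$ is identified with the tree in $\Sigma_2^*$ consisting of all vertices $\alpha$ with $qP_\alpha\neq0$. The set $\Omega_2$ is regarded as a subset of $\Sigma_2\times\Sigma_2^*$ via the embedding $q\mapsto(q,1-q)$, and $\Sigma_2\times\Sigma_2^*$ has the product topology. *)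

(* Defs.v *)
From HB Require Import structures.
From mathcomp Require Import all_boot all_order all_algebra.
From mathcomp Require Import finmap.
From mathcomp Require Import complex.
From mathcomp Require Import all_classical all_reals all_analysis.

Set Implicit Arguments.
Unset Strict Implicit.
Unset Printing Implicit Defensive.

Import Order.TTheory GRing.Theory Num.Theory.
Import numFieldNormedType.Exports.

Local Open Scope classical_set_scope.
Local Open Scope ring_scope.
Local Open Scope complex_scope.

(* Unital complex C*-algebras. The norm takes its values in R[i] and is        *)
(* nonnegative there; the last field is the C*-identity. The product is a      *)
(* field because no structure can join algType with normed modules (such a     *)
(* structure would have to precede numDomainType); the algType instance is     *)
(* derived just below.                                                         *)
HB.mixin Record isCStarAlgebra (R : realType) A
    of CompleteNormedModule R[i] A := {
  cstar_one : A;
  cstar_mul : A -> A -> A;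
  cstar_mulA : associative cstar_mul;
  cstar_mul1 : left_id cstar_one cstar_mul;
  cstar_mulr1 : right_id cstar_one cstar_mul;
  cstar_mulDl : left_distributive cstar_mul +%R;
  cstar_mulDr : right_distributive cstar_mul +%R;
  cstar_one_neq0 : cstar_one != 0;
  cstar_scaleAl : forall (c : R[i]) (x y : A),
    c *: cstar_mul x y = cstar_mul (c *: x) y;
  cstar_scaleAr : forall (c : R[i]) (x y : A),
    c *: cstar_mul x y = cstar_mul x (c *: y);
  star : A -> A;
  starK : involutive star;
  starD : {morph star : x y / x + y};
  starZ : forall (c : R[i]) (x : A), star (c *: x) = c^* *: star x;
  starM : forall x y : A, star (cstar_mul x y) = cstar_mul (star y) (star x);
  cstar_normM : forall x y : A, `|cstar_mul x y| <= `|x| * `|y|;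
  cstar_normX : forall x : A, `|cstar_mul (star x) x| = `|x| ^+ 2
}.

#[short(type="cstarAlgType")]
HB.structure Definition CStarAlgebra (R : realType) :=
  {A of isCStarAlgebra R A & CompleteNormedModule R[i] A}.

HB.instance Definition _ (R : realType) (A : cstarAlgType R) :=
  GRing.Zmodule_isNzRing.Build A (@cstar_mulA R A) (@cstar_mul1 R A)
    (@cstar_mulr1 R A) (@cstar_mulDl R A) (@cstar_mulDr R A)
    (@cstar_one_neq0 R A).
HB.instance Definition _ (R : realType) (A : cstarAlgType R) :=
  GRing.Lmodule_isLalgebra.Build R[i] A (@cstar_scaleAl R A).
HB.instance Definition _ (R : realType) (A : cstarAlgType R) :=
  GRing.Lalgebra_isAlgebra.Build R[i] A (@cstar_scaleAr R A).

Section CuntzAlgebra.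
Context {R : realType} {A : cstarAlgType R}.

Definition cstar_subalgebra (B : set A) : Prop :=
  [/\ B 1, closed B,
      forall (c : R[i]) (x y : A), B x -> B y -> B (c *: x + y),
      forall x y : A, B x -> B y -> B (x * y)
    & forall x : A, B x -> B (star x)].

(* A together with S is (a copy of) the Cuntz algebra O_2: all such pairs are  *)
(* isomorphic. The letters 1 and 2 of the alphabet are false and true.         *)
Definition cuntz2 (S : bool -> A) : Prop :=
  [/\ forall i, star (S i) * S i = 1,
      S false * star (S false) + S true * star (S true) = 1
    & forall B, cstar_subalgebra B -> (forall i, B (S i)) -> B = setT].

End CuntzAlgebra.

Definition word : choiceType := seq bool.

Definition word_lt (a b : word) : bool :=
  ((a : seqlexi bool) < (b : seqlexi bool))%O.

Section ThompsonGroup.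
Context {R : realType} {A : cstarAlgType R} (S : bool -> A).

Definition Sw (mu : word) : A := \prod_(i <- mu) S i.

Definition Pw (mu : word) : A := Sw mu * star (Sw mu).

Definition unitary (u : A) : Prop := star u * u = 1 /\ u * star u = 1.

(* f is presented by the finite set J: J is the graph of an order preserving   *)
(* bijection between its sets J_1 and J_2 of first and second coordinates.     *)
Definition presents (J : {fset word * word}) (f : A) : Prop :=
  [/\ {in J &, injective (fun x => x.1)} /\
      {in J &, injective (fun x => x.2)},
      (\sum_(a <- [fset x.1 | x in J]%fset) Pw a = 1) /\
      (\sum_(b <- [fset x.2 | x in J]%fset) Pw b = 1),
      {in J &, forall x y, word_lt x.1 y.1 = word_lt x.2 y.2}
    & f = \sum_(x <- J) Sw x.1 * star (Sw x.2)].

Definition thompsonF : set A :=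
  [set f | unitary f /\ exists J, presents J f].

(* A presentation of f, whose choice is irrelevant in part0 and part1.         *)
Definition presentation (f : A) : {fset word * word} :=
  xget fset0%fset [set J | presents J f].

(* |a| - |b| is even exactly when |a| and |b| have the same parity.            *)
Definition part0 (f : A) : A :=
  \sum_(x <- presentation f | odd (size x.1) == odd (size x.2))
     Sw x.1 * star (Sw x.2).

Definition part1 (f : A) : A :=
  \sum_(x <- presentation f | odd (size x.1) != odd (size x.2))
     Sw x.1 * star (Sw x.2).

Definition Omega2 : set A :=
  [set part0 f * star (part0 f) | f in thompsonF].

Definition act (f p : A) : A :=
  part0 f * p * star (part0 f) + part1 f * (1 - p) * star (part1 f).

End ThompsonGroup.

(* Sets of vertices of the infinite binary rooted tree, that is {0,1}^W_2 with *)
(* the product topology. The successors of a are rcons a false, rcons a true.  *)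
Notation vertices := {ptws word -> bool}.

Definition rooted_subtree (t : vertices) : Prop :=
  t [::] /\ forall a i, t (rcons a i) -> t a.

Definition leafless (t : vertices) : Prop :=
  forall a, t a -> exists i, t (rcons a i).

Definition Sigma2 : set vertices := [set t | rooted_subtree t /\ leafless t].

Definition Sigma2s : set vertices := Sigma2 `|` [set (fun=> false)].

Section OmegaClosure.
Context {R : realType} {A : cstarAlgType R} (S : bool -> A).

Definition tree_of (q : A) : vertices := fun a => q * Pw S a != 0.

Definition embed (q : A) : vertices * vertices := (tree_of q, tree_of (1 - q)).

(* The closure relative to the subspace Sigma2 `*` Sigma2s. Coerced to a type, *)
(* this set carries the subspace topology.                                     *)
Definition Omega2_closure : set (vertices * vertices) :=
  closure (embed @` Omega2 S) `&` (Sigma2 `*` Sigma2s).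

End OmegaClosure.

Definition homeomorphism (X Y : topologicalType) (g : X -> Y) : Prop :=
  continuous g /\ exists h : Y -> X, [/\ continuous h, cancel g h & cancel h g].

Section Extension.
Context {R : realType} {A : cstarAlgType R} (S : bool -> A).

(* The multiplication of the group F is that of the ambient algebra.           *)
Definition is_action (T : Type) (phi : thompsonF S -> T -> T) : Prop :=
  (forall (e : thompsonF S) x, \val e = 1 -> phi e x = x) /\
  (forall (f g h : thompsonF S) x,
     \val h = \val f * \val g -> phi h x = phi f (phi g x)).

Definition extends_act
    (phi : thompsonF S -> Omega2_closure S -> Omega2_closure S) : Prop :=
  forall (f : thompsonF S) (q : A) (x : Omega2_closure S),
    Omega2 S q -> \val x = embed S q ->
    \val (phi f x) = embed S (act S (\val f) q).

End Extension.

(* Main.v *)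
Require Import Defs.
From HB Require Import structures.
From mathcomp Require Import all_boot all_order all_algebra.
From mathcomp Require Import finmap.
From mathcomp Require Import complex.
From mathcomp Require Import all_classical all_reals all_analysis.

(* For f in F and a long word mu, f^* S_mu = S_(tau mu) for a word tau mu,
   and f . p is determined on long words by p and the parities of the lengths:
   if p S_(tau mu) is S_(tau mu) or 0, then (f . p) S_mu is S_mu or 0
   accordingly, the two cases being exchanged when |mu| and |tau mu| have
   different parities. Since x = sum_(|w| = n) x S_w S_w^*, every identity
   between such elements can be tested on long words; this gives the action
   law. At the level of trees a coordinate of (f . p, 1 - f . p) is a finite
   disjunction of coordinates of (p, 1 - p), so the action extends
   continuously to all pairs of trees; it preserves the closure of Omega_2,
   and all that remains follows by density. *)

Set Implicit Arguments.
Unset Strict Implicit.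
Unset Printing Implicit Defensive.

Import Order.TTheory GRing.Theory Num.Theory.
Import numFieldNormedType.Exports.

Local Open Scope classical_set_scope.
Local Open Scope ring_scope.

(** * Finite binary words, prefixes and the lexicographic order *)

Fixpoint words (n : nat) : seq (seq bool) :=
  if n is n'.+1 then map (cons false) (words n') ++ map (cons true) (words n')
  else [:: [::]].

Lemma mem_words n w : (w \in words n) = (size w == n).
Proof.
elim: n w => [|n IH] [|[] w] //=; rewrite mem_cat.
- by apply/negP => /orP[] /mapP[].
- rewrite (mem_map (fun _ _ => _)) ?IH => [|? ? []//].
  by rewrite eqSS; case: (_ == _) => //=; rewrite ?orbT// orbF; apply/negP=> /mapP[].
- rewrite (mem_map (fun _ _ => _)) ?IH => [|? ? []//].
  by rewrite eqSS; case: (_ == _) => //=; apply/negP=> /mapP[].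
Qed.

Lemma words_uniq n : uniq (words n).
Proof.
elim: n => //= n IH; rewrite cat_uniq !map_inj_uniq ?IH//=; last 2 first.
- by move=> ? ? [].
- by move=> ? ? [].
by rewrite andbT; apply/hasPn => _ /mapP[w _ ->]; apply/negP => /mapP[].
Qed.

Lemma size_words n : size (words n) = (2 ^ n)%N.
Proof. by elim: n => //= n IH; rewrite size_cat !size_map IH expnS mul2n addnn. Qed.

(** Divided by [2 ^ n], this count is the uniform measure of the cylinder of [w]. *)
Lemma count_prefix_words n w : (size w <= n)%N ->
  count (prefix w) (words n) = (2 ^ (n - size w))%N.
Proof.
elim: n w => [|n IH] [|i w] //= le_wn.
  by rewrite count_cat !count_map /= !(@eq_count _ _ predT) ?count_predT
     ?size_words ?subn0 ?expnS ?mul2n ?addnn// => u; rewrite /= ?prefix0s.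
have eqn : count (preim (cons i) (prefix (i :: w))) (words n) = count (prefix w) (words n).
  by apply: eq_count => u /=; rewrite eqxx.
have neqn : count (preim (cons (~~ i)) (prefix (i :: w))) (words n) = 0%N.
  by rewrite (@eq_count _ _ pred0) ?count_pred0// => u /=; case: (i).
rewrite count_cat !count_map subSS -IH// -eqn.
by case: i eqn neqn => _ ->; rewrite ?addn0.
Qed.

Definition incomparable (a b : seq bool) := ~~ prefix a b && ~~ prefix b a.

Lemma incomparable_size a b : size a = size b -> a != b -> incomparable a b.
Proof.
by move=> s ab; rewrite /incomparable !prefixE s take_size -{1}s take_size -[b == a]eq_sym ab.
Qed.

Lemma incomparable_cons i a b : incomparable (i :: a) (i :: b) = incomparable a b.
Proof. by rewrite /incomparable !prefix_cons eqxx. Qed.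

Lemma word_lt_cons i j (a b : seq bool) :
  word_lt (i :: a) (j :: b) = if i == j then word_lt a b else ~~ i.
Proof. by rewrite /word_lt Order.SeqLexiOrder.Exports.ltxi_cons; case: i; case: j. Qed.

Lemma word_lt_cat2 (a b c : seq bool) : word_lt (a ++ b) (a ++ c) = word_lt b c.
Proof. by elim: a => //= i a IH; rewrite word_lt_cons eqxx. Qed.

(** Incomparable words first differ at a letter inside both, which decides the order whatever tails
    follow. *)
Lemma word_lt_incomparable (a b a' b' : seq bool) : incomparable a b ->
  word_lt (a ++ a') (b ++ b') = word_lt a b.
Proof.
elim: a b => [|i a IH] [|j b]; try by rewrite /incomparable ?prefix0s ?andbF.
rewrite !cat_cons !word_lt_cons; case: (eqVneq i j) => [->|//].
by rewrite incomparable_cons; apply: IH.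
Qed.

Lemma word_ltxx (a : seq bool) : word_lt a a = false.
Proof. exact: ltxx. Qed.

(** * Star-algebra identities *)

Section StarAlgebra.
Context {R : realType} {A : cstarAlgType R}.
Implicit Types x y : A.

Lemma star0 : star (0 : A) = 0.
Proof. by apply: (addrI (star (0 : A))); rewrite -starD !addr0. Qed.

Lemma starMr x y : star (x * y) = star y * star x.
Proof. exact: starM. Qed.

Lemma star1 : star (1 : A) = 1.
Proof. by rewrite -[LHS]mulr1 -[X in _ * X](starK (1 : A)) -starMr mulr1 starK. Qed.

Lemma star_sum (I : Type) (r : seq I) (P : pred I) (F : I -> A) :
  star (\sum_(i <- r | P i) F i) = \sum_(i <- r | P i) star (F i).
Proof. by apply: (big_morph _ _ star0) => x y; rewrite starD. Qed.

(** The scalars have characteristic zero; this turns identities between multiples of [1] into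
    counting statements. *)
Lemma natr_cstar_inj (m n : nat) : m%:R = n%:R :> A -> m = n.
Proof.
wlog le_nm : m n / (n <= m)%N => [W|] e.
  by case/orP: (leq_total n m) => h; [exact: W|symmetry; exact: W].
have /eqP : (m - n)%:R *: (1 : A) = 0.
  by rewrite scaler_nat natrB// e subrr.
rewrite scaler_eq0 oner_eq0 orbF pnatr_eq0 subn_eq0 => le_mn.
by apply/eqP; rewrite eqn_leq le_mn.
Qed.

End StarAlgebra.

(** * Words in the generators of the Cuntz algebra *)

Section Cuntz.
Context {R : realType} {A : cstarAlgType R} (S : bool -> A).
Hypothesis hS : cuntz2 S.

Let isoS i : star (S i) * S i = 1.
Proof. by case: hS. Qed.

Let sumS : S false * star (S false) + S true * star (S true) = 1.
Proof. by case: hS. Qed.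

(** For [i != j], sandwiching [S_i S_i^* + S_j S_j^* = 1] between [S_i^*] and [S_j] gives
    [x + x = x] for [x = S_i^* S_j]. *)
Lemma star_gen_mul i j : star (S i) * S j = (i == j)%:R.
Proof.
have key k : star (S k) * S (~~ k) = 0.
  have sumk : S k * star (S k) + S (~~ k) * star (S (~~ k)) = 1.
    by case: k; rewrite //= addrC.
  have : star (S k) * (S k * star (S k) + S (~~ k) * star (S (~~ k))) * S (~~ k)
       = star (S k) * S (~~ k) by rewrite sumk mulr1.
  rewrite mulrDr mulrDl !mulrA isoS mul1r -(mulrA _ _ (S (~~ k))) isoS mulr1.
  by move/(canRL (addrK _)); rewrite subrr.
case: (eqVneq i j) => [<-|]; first exact: isoS.
by move: (key i); case: i; case: j.
Qed.

Lemma Sw_nil : Sw S [::] = 1.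
Proof. by rewrite /Sw big_nil. Qed.

Lemma Sw_cons i w : Sw S (i :: w) = S i * Sw S w.
Proof. by rewrite /Sw big_cons. Qed.

Lemma Sw_cat a b : Sw S (a ++ b) = Sw S a * Sw S b.
Proof. by rewrite /Sw big_cat. Qed.

Lemma Sw_isometry w : star (Sw S w) * Sw S w = 1.
Proof.
elim: w => [|i w IH]; first by rewrite Sw_nil star1 mulr1.
by rewrite Sw_cons starMr -mulrA (mulrA (star (S i))) isoS mul1r.
Qed.

Lemma star_Sw_mul_cat a b : star (Sw S a) * Sw S (a ++ b) = Sw S b.
Proof. by rewrite Sw_cat mulrA Sw_isometry mul1r. Qed.

Lemma Sw_neq0 w : Sw S w != 0.
Proof.
apply/eqP => e; have := Sw_isometry w; rewrite e mulr0 => /esym/eqP.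
by rewrite oner_eq0.
Qed.

Lemma star_Sw_mul_incomparable a b : incomparable a b ->
  star (Sw S a) * Sw S b = 0.
Proof.
elim: a b => [|i a IH] [|j b]; try by rewrite /incomparable ?prefix0s ?andbF.
rewrite !Sw_cons starMr -mulrA (mulrA (star (S i))) star_gen_mul.
case: (eqVneq i j) => [<-|_ _]; last by rewrite mul0r mulr0.
by rewrite mul1r incomparable_cons; apply: IH.
Qed.

Lemma star_Sw_mul_eq0 a b : (star (Sw S a) * Sw S b == 0) = incomparable a b.
Proof.
apply/eqP/idP => [|/star_Sw_mul_incomparable//].
apply: contraPT; rewrite negb_and !negbK => /orP[] /prefixP[c ->].
  by rewrite star_Sw_mul_cat; apply/eqP/Sw_neq0.
move=> /(congr1 star); rewrite starMr starK star_Sw_mul_cat star0.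
exact/eqP/Sw_neq0.
Qed.

Lemma Sw_inj : injective (Sw S).
Proof.
move=> a b; elim: a b => [|i a IH] [|j b] //.
(* The adjoint of the other generator kills a word starting with [j] but not [1]. *)
- rewrite Sw_nil => /(congr1 (fun x => star (Sw S [:: ~~ j]) * x)).
  rewrite star_Sw_mul_incomparable ?mulr1; last by case: j.
  move=> /(congr1 star); by rewrite starK star0 => /eqP; rewrite (negPf (Sw_neq0 _)).
- rewrite Sw_nil => /esym /(congr1 (fun x => star (Sw S [:: ~~ i]) * x)).
  rewrite star_Sw_mul_incomparable ?mulr1; last by case: (i).
  move=> /(congr1 star); by rewrite starK star0 => /eqP; rewrite (negPf (Sw_neq0 _)).
rewrite !Sw_cons => e.
have := congr1 (fun x => star (S i) * x) e.
rewrite !mulrA !star_gen_mul eqxx mul1r.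
case: eqVneq => [->|_]; first by rewrite mul1r => /IH ->.
by rewrite mul0r => /eqP; rewrite (negPf (Sw_neq0 a)).
Qed.

Lemma Pw_eq0 x a : (x * Pw S a == 0) = (x * Sw S a == 0).
Proof.
apply/eqP/eqP => [e|e]; last by rewrite /Pw mulrA e mul0r.
by rewrite -[Sw S a]mulr1 -(Sw_isometry a) !mulrA -(mulrA x) e mul0r.
Qed.

Lemma Pw_cat_eq0 x a b : x * Pw S a = 0 -> x * Pw S (a ++ b) = 0.
Proof.
by move/eqP; rewrite Pw_eq0 => /eqP e; apply/eqP; rewrite Pw_eq0 Sw_cat mulrA e mul0r.
Qed.

Lemma sum_Pw_words a n : \sum_(w <- words n) Pw S (a ++ w) = Pw S a.
Proof.
elim: n a => [|n IH] a; first by rewrite big_seq1 cats0.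
rewrite /= big_cat !big_map /=.
under eq_bigr do rewrite -cat_rcons.
under [X in _ + X]eq_bigr do rewrite -cat_rcons.
rewrite !IH /Pw -!cats1 !Sw_cat !starMr /Sw !big_seq1 !mulrA -!(mulrA (\prod_(i <- a) S i)).
by rewrite -mulrDr -mulrDl sumS mul1r.
Qed.

Lemma eq_on_words n x y :
  (forall w, size w = n -> x * Sw S w = y * Sw S w) -> x = y.
Proof.
move=> e; rewrite -[x]mulr1 -[y]mulr1.
have <- : \sum_(w <- words n) Pw S w = 1.
  by rewrite (sum_Pw_words [::] n) /Pw Sw_nil star1 mulr1.
rewrite !mulr_sumr !big_seq; apply: eq_bigr => w; rewrite mem_words => /eqP /e h.
by rewrite /Pw !mulrA h.
Qed.

(** [P_a] is the sum of the [P_(aw)] with [|w| = n], so membership of a vertex can be tested on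
    arbitrarily long words. *)
Lemma tree_of_words q a n :
  Defs.tree_of S q a = has (fun w => q * Sw S (a ++ w) != 0) (words n).
Proof.
apply/idP/hasP => [|[w _]]; last first.
  by rewrite /Defs.tree_of -Pw_eq0; apply: contraNN => /eqP /Pw_cat_eq0 ->.
apply: contraPP => h.
rewrite /Defs.tree_of -(sum_Pw_words a n) mulr_sumr big_seq big1 ?eqxx// => w wn.
apply/eqP; rewrite Pw_eq0; apply: contra_notT h => h; by exists w.
Qed.

End Cuntz.

(** * Partitions of unity by words, and tables of pairs of words *)

Lemma prefix_longer (a b : seq bool) : (size a <= size b)%N -> prefix b a -> prefix a b.
Proof.
move=> le_ab /prefixP[c e]; move: le_ab; rewrite e size_cat -[X in (_ <= X)%N]addn0 leq_add2l.
by case: c {e} => // _; rewrite cats0 prefix_refl.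
Qed.

Section CuntzPresentation.
Context {R : realType} {A : cstarAlgType R} (S : bool -> A).
Hypothesis hS : cuntz2 S.

Lemma compress_Pw a mu : (size a <= size mu)%N ->
  star (Sw S mu) * Pw S a * Sw S mu = (prefix a mu)%:R.
Proof.
move=> le_a; rewrite /Pw mulrA -mulrA; case: (boolP (prefix a mu)) => [/prefixP[c ->]|np].
  by rewrite star_Sw_mul_cat// Sw_cat starMr -(mulrA _ _ (Sw S a)) !Sw_isometry// mulr1 Sw_isometry.
rewrite star_Sw_mul_incomparable ?mul0r//.
by rewrite /incomparable np andbT; apply: contra np; exact: prefix_longer.
Qed.

Section Table.
Context (T : eqType) (J : seq T) (u v : T -> word) (mu : word).
Hypothesis J_uniq : uniq J.
Hypothesis sumJ : \sum_(x <- J) Pw S (v x) = 1.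
Hypothesis mu_long : {in J, forall x, (size (v x) <= size mu)%N}.

(** Compressing the partition of unity by [S_mu] turns each [P_(v x)] into [1] or [0], so the number
    of prefixes of [mu] among the [v x] equals [1] in [A]. *)
Lemma count_prefix_partition : count (fun x => prefix (v x) mu) J = 1%N.
Proof.
apply: (@natr_cstar_inj R A).
have -> : 1%:R = star (Sw S mu) * (\sum_(x <- J) Pw S (v x)) * Sw S mu :> A.
  by rewrite sumJ mulr1 Sw_isometry.
rewrite -sum1_count natr_sum mulr_sumr mulr_suml.
rewrite big_mkcond big_seq [RHS]big_seq; apply: eq_bigr => x /mu_long le_x.
by rewrite compress_Pw//; case: ifP.
Qed.

Lemma prefix_partition_ex : exists2 x, x \in J & prefix (v x) mu.
Proof.
by apply/hasP; rewrite has_count count_prefix_partition.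
Qed.

Lemma prefix_partition_inj x y : x \in J -> y \in J ->
  prefix (v x) mu -> prefix (v y) mu -> x = y.
Proof.
move=> xJ yJ px py; have := count_prefix_partition; rewrite -size_filter.
have : x \in [seq z <- J | prefix (v z) mu] by rewrite mem_filter px.
have : y \in [seq z <- J | prefix (v z) mu] by rewrite mem_filter py.
by case: [seq z <- J | prefix (v z) mu] => [|z [|? ?]] //; rewrite !inE => /eqP -> /eqP ->.
Qed.

(** Only the row whose [v]-word is a prefix of [mu] survives. With [u], [v] and [P] free, one
    computation covers a table and its adjoint, whole or restricted to one parity. *)
Lemma partition_sum_mul (P : pred T) x : x \in J -> prefix (v x) mu ->
  (\sum_(y <- J | P y) Sw S (u y) * star (Sw S (v y))) * Sw S mu =
  Sw S (u x ++ drop (size (v x)) mu) *+ P x.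
Proof.
move=> xJ px; rewrite mulr_suml big_mkcond (bigD1_seq x)//= [X in _ + X]big_seq_cond big1.
  rewrite addr0 mulrb; case: ifP => // _.
  case/prefixP: px => c ->; rewrite drop_size_cat// -mulrA star_Sw_mul_cat//.
  by rewrite Sw_cat.
move=> y /andP[yJ yx]; case: ifP => // _; rewrite -mulrA star_Sw_mul_incomparable ?mulr0//.
have np : ~~ prefix (v y) mu.
  by apply: contra_neqN yx => py; apply: prefix_partition_inj.
by rewrite /incomparable np; apply: contra np; apply: prefix_longer; exact: mu_long.
Qed.

End Table.

Lemma presents_sums J f : presents S J f ->
  \sum_(x <- J) Pw S x.1 = 1 /\ \sum_(x <- J) Pw S x.2 = 1.
Proof.
case=> [[inj1 inj2] [sum1 sum2] _ _]; split.
- by rewrite -sum1 big_imfset.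
- by rewrite -sum2 big_imfset.
Qed.

Lemma star_table (J : seq (word * word)) (P : pred (word * word)) :
  star (\sum_(x <- J | P x) Sw S x.1 * star (Sw S x.2)) =
  \sum_(x <- J | P x) Sw S x.2 * star (Sw S x.1).
Proof. by rewrite star_sum; apply: eq_bigr => x _; rewrite starMr starK. Qed.

(* [tau] is defined by [star f], not [f], because the action of [f] pulls trees
   back along [tau]. *)
Definition implements (f : A) (N : nat) (tau : word -> word) : Prop :=
  [/\ forall mu, (N <= size mu)%N -> star f * Sw S mu = Sw S (tau mu),
      forall mu, (N <= size mu)%N -> (size mu <= size (tau mu) + N)%N,
      forall mu nu, (N <= size mu)%N -> (N <= size nu)%N -> incomparable mu nu ->
        word_lt (tau mu) (tau nu) = word_lt mu nu
    & forall mu q (b : bool), (N <= size mu)%N ->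
        q * Sw S (tau mu) = Sw S (tau mu) *+ b ->
        act S f q * Sw S mu =
        Sw S mu *+ (b (+) (odd (size mu) (+) odd (size (tau mu))))].

Lemma thompson_implements f : thompsonF S f -> exists N tau, implements f N tau.
Proof.
move=> [_ exJ]; rewrite /implements /act /part0 /part1.
have pJ : presents S (presentation S f) f by exact: xgetPex exJ.
move: (presentation S f) pJ => J pJ; have [sum1 sum2] := presents_sums pJ.
have J_uniq := fset_uniq J; case: pJ => [_ _ J_lt fE].
(* From length [N1 + N2] on, [mu] is at least as long as every first coordinate, and [tau mu],
   losing at most [N1] letters, at least as long as every second one. *)
pose N1 := (\max_(x <- J) size x.1)%N; pose N2 := (\max_(x <- J) size x.2)%N.
have leN1 x : x \in J -> (size x.1 <= N1)%N.
  by move=> xJ; rewrite /N1; exact: (@leq_bigmax_seq _ _ xpredT (fun x : word * word => size x.1)).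
have leN2 x : x \in J -> (size x.2 <= N2)%N.
  by move=> xJ; rewrite /N2; exact: (@leq_bigmax_seq _ _ xpredT (fun x : word * word => size x.2)).
(* The row whose first coordinate is a prefix of [mu]; [tau] replaces that prefix by the second
   coordinate. For long [mu] such a row exists, so the default of [nth] is never reached. *)
pose p (mu : word) : word * word := nth ([::], [::]) J (find (fun x => prefix x.1 mu) J).
pose tau (mu : word) : word := (p mu).2 ++ drop (size (p mu).1) mu.
have le1 (mu : word) : (N1 + N2 <= size mu)%N -> {in J, forall x : word * word, (size x.1 <= size mu)%N}.
  move=> le_mu x xJ; apply: leq_trans le_mu; apply: leq_trans (leq_addr _ _).
  exact: leN1.
have pP (mu : word) : (N1 + N2 <= size mu)%N -> p mu \in J /\ prefix (p mu).1 mu.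
  move=> /le1 le_mu.
  have hasp : has (fun x => prefix x.1 mu) J.
    by apply/hasP; exact: (prefix_partition_ex sum1).
  by split; [rewrite mem_nth// -has_find | exact: (nth_find _ hasp)].
have sz (mu : word) : (N1 + N2 <= size mu)%N ->
    size (tau mu) = (size (p mu).2 + (size mu - size (p mu).1))%N.
  by rewrite size_cat size_drop.
have tau_long (mu : word) : (N1 + N2 <= size mu)%N -> {in J, forall x : word * word, (size x.2 <= size (tau mu))%N}.
  move=> le_mu x xJ; rewrite sz//; apply: leq_trans (leq_addl _ _).
  have h1 : (size (p mu).1 <= N1)%N.
    by apply: leN1; case: (pP _ le_mu).
  have h2 := leN2 _ xJ.
  by rewrite leq_subRL; [rewrite (leq_trans _ le_mu)// leq_add | rewrite (leq_trans h1)// (leq_trans _ le_mu)// leq_addr].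
have tau_prefix (mu : word) : prefix (p mu).2 (tau mu) by exact: prefix_prefix.
have muE (mu : word) : (N1 + N2 <= size mu)%N -> mu = (p mu).1 ++ drop (size (p mu).1) mu.
  move=> /pP[_]; rewrite prefixE => /eqP e.
  by rewrite -[LHS](cat_take_drop (size (p mu).1)) e.
have starP (P : pred (word * word)) (mu : word) : (N1 + N2 <= size mu)%N ->
    star (\sum_(x <- J | P x) Sw S x.1 * star (Sw S x.2)) * Sw S mu =
    Sw S (tau mu) *+ P (p mu).
  move=> le_mu; rewrite star_table; have [xJ px] := pP _ le_mu.
  exact: (partition_sum_mul snd J_uniq sum1 (le1 _ le_mu)).
have mulP (P : pred (word * word)) (mu : word) : (N1 + N2 <= size mu)%N ->
    (\sum_(x <- J | P x) Sw S x.1 * star (Sw S x.2)) * Sw S (tau mu) =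
    Sw S mu *+ P (p mu).
  move=> le_mu; have [xJ px] := pP _ le_mu.
  rewrite (partition_sum_mul fst J_uniq sum2 (tau_long _ le_mu) _ xJ)//.
  by rewrite /tau drop_size_cat// -muE.
exists (N1 + N2)%N, tau; split.
- by move=> mu le_mu; rewrite fE (starP predT).
- move=> mu le_mu; rewrite sz//; have [xJ px] := pP _ le_mu.
  have h1 := leN1 _ xJ.
  rewrite (@leq_trans (size mu - size (p mu).1 + N1))//; last by rewrite leq_add ?leq_addl ?leq_addr.
  by rewrite addnC -leq_subLR leq_sub2l.
- move=> mu nu le_mu le_nu inc; rewrite [in RHS](muE mu)// [in RHS](muE nu)//.
  have [xJ px] := pP _ le_mu; have [yJ py] := pP _ le_nu.
  (* Within one row only the tails are compared. Distinct rows have incomparable coordinates, as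
     otherwise both would give prefixes of one long word; then the table decides the order. *)
  have [e|ne] := eqVneq (p mu) (p nu).
    by rewrite /tau e !word_lt_cat2.
  rewrite !word_lt_incomparable ?J_lt//.
  + apply/andP; split; apply: contra_neqN ne => pre.
      apply: (prefix_partition_inj sum1 (le1 _ le_nu)) => //; exact: prefix_trans pre py.
    by apply: (prefix_partition_inj sum1 (le1 _ le_mu)) => //; exact: prefix_trans pre px.
  + apply/andP; split; apply: contra_neqN ne => pre.
      apply: (prefix_partition_inj sum2 (tau_long _ le_nu)) => //; exact: prefix_trans pre _.
    by apply: (prefix_partition_inj sum2 (tau_long _ le_mu)) => //; exact: prefix_trans pre _.
- move=> mu q b le_mu qE.
  have -> : odd (size mu) (+) odd (size (tau mu)) =
            (odd (size (p mu).1) != odd (size (p mu).2)).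
    rewrite sz// {1}(muE mu)// size_cat size_drop !oddD.
    by case: (odd (_ - _)); case: odd; case: odd.
  (* Exactly one of [f_0^*] and [f_1^*] is nonzero on [S_mu], so one summand of the action remains:
     the one with [q] for an even row, with [1 - q] for an odd row. *)
  rewrite mulrDl -!mulrA !starP//=.
  case par: (odd (size (p mu).1) == odd (size (p mu).2)) => /=.
    by rewrite mulr0n mulr1n !mulr0 addr0 qE mulrnAr mulP// par addbF mulr1n.
  rewrite mulr0n mulr1n !mulr0 add0r mulrBl mul1r qE mulrBr mulrnAr mulP// par /= addbT mulr1n.
  by case: (b); rewrite ?subrr ?subr0.
Qed.

End CuntzPresentation.

(** * The group law of F and its action on projections *)

Section ThompsonGroupAction.
Context {R : realType} {A : cstarAlgType R} (S : bool -> A).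
Hypothesis hS : cuntz2 S.

(** A converse to [thompson_implements]: the pairs [(w, tau w)] with [|w| = N] form a presentation,
    whose second coordinates give a partition of unity because [P_(tau w) = f^* P_w f]. *)
Lemma thompson_of_table f N (tau : word -> word) : unitary f ->
  (forall mu, size mu = N -> star f * Sw S mu = Sw S (tau mu)) ->
  (forall mu nu, size mu = N -> size nu = N -> incomparable mu nu ->
     word_lt (tau mu) (tau nu) = word_lt mu nu) ->
  thompsonF S f.
Proof.
move=> uf tauE tau_lt; split=> //; case: uf => fVf ffV.
have tau_inj : {in words N &, injective tau}.
  move=> a b; rewrite !mem_words => /eqP aN /eqP bN /(congr1 (Sw S)).
  rewrite -!tauE// => /(congr1 (fun x => f * x)); rewrite !mulrA ffV !mul1r.
  exact: (Sw_inj hS).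
pose J : {fset word * word} := [fset ((w : word), tau w) | w in (words N : seq word)]%fset.
have sumJ (F : word * word -> A) : \sum_(x <- J) F x = \sum_(w <- words N) F (w, tau w).
  rewrite /J big_imfset//=; last by move=> ? ? _ _ [].
  by rewrite undup_id// words_uniq.
have JP x : x \in J -> exists2 w, size w = N & x = (w, tau w).
  by case/imfsetP => w /=; rewrite mem_words => /eqP wN ->; exists w.
have inj1 : {in J &, injective (fun x => x.1)}.
  by move=> _ _ /JP[a _ ->] /JP[b _ ->] /= ->.
have inj2 : {in J &, injective (fun x => x.2)}.
  move=> _ _ /JP[a aN ->] /JP[b bN ->] /= /tau_inj -> //; by rewrite mem_words ?aN ?bN.
have sum1 : \sum_(w <- words N) Pw S w = 1.
  by rewrite (sum_Pw_words hS [::] N) /Pw Sw_nil star1 mulr1.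
exists J; split.
- by split.
- split; rewrite big_imfset//= sumJ//=.
  rewrite -fVf -[X in _ = _ * X]mul1r -sum1 mulr_suml mulr_sumr !big_seq.
  apply: eq_bigr => w; rewrite mem_words => /eqP wN.
  by rewrite {1}/Pw -tauE// starMr starK /Pw !mulrA.
- move=> _ _ /JP[a aN ->] /JP[b bN ->] /=; have [->|ab] := eqVneq a b.
    by rewrite !word_ltxx.
  by rewrite tau_lt// incomparable_size// aN bN.
rewrite sumJ -[LHS]mul1r -sum1 mulr_suml !big_seq.
apply: eq_bigr => w; rewrite mem_words => /eqP wN /=.
by rewrite -tauE// starMr starK /Pw !mulrA.
Qed.

Lemma thompson1 : thompsonF S 1.
Proof.
apply: (@thompson_of_table _ 0 id) => //.
  by split; rewrite star1 mulr1.
by move=> mu _; rewrite star1 mul1r.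
Qed.

Lemma thompsonM f g : thompsonF S f -> thompsonF S g -> thompsonF S (f * g).
Proof.
move=> Ff Fg.
have [N [tau [tauE tau_size tau_lt _]]] := thompson_implements hS Ff.
have [M [ups [upsE _ ups_lt _]]] := thompson_implements hS Fg.
have [[[fVf ffV] _] [[gVg ggV] _]] := (Ff, Fg).
have long mu : size mu = (N + M)%N -> (N <= size mu)%N /\ (M <= size (tau mu))%N.
  move=> muN; have le_mu : (N <= size mu)%N by rewrite muN leq_addr.
  by split=> //; have := tau_size _ le_mu; rewrite muN addnC leq_add2r.
apply: (@thompson_of_table _ (N + M)%N (ups \o tau)).
- split; rewrite starMr.
    by rewrite mulrA -(mulrA (star g)) fVf mulr1.
  by rewrite mulrA -(mulrA f) ggV mulr1.
- by move=> mu /long[h1 h2]; rewrite starMr -mulrA tauE//= upsE.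
move=> mu nu /long[h1 h2] /long[h3 h4] inc /=.
(* Incomparability survives [tau], since [S_(tau mu)^* S_(tau nu) = S_mu^* f f^* S_nu = S_mu^*
   S_nu]. *)
rewrite ups_lt ?tau_lt// -(star_Sw_mul_eq0 hS) -!tauE// starMr starK mulrA.
by rewrite -(mulrA _ f) ffV mulr1 star_Sw_mul_eq0.
Qed.

Lemma thompson_star f : thompsonF S f -> thompsonF S (star f).
Proof.
move=> [[fVf ffV] [J [[inj1 inj2] [sum1 sum2] J_lt fE]]].
split; first by split; rewrite starK.
exists [fset (x.2, x.1) | x in J]%fset.
have swap_inj : {in J &, injective (fun x : word * word => (x.2, x.1))}.
  by move=> [? ?] [? ?] _ _ [-> ->].
have inj1' : {in [fset (x.2, x.1) | x in J]%fset &, injective (fun x : word * word => x.1)}.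
  by move=> _ _ /imfsetP[x xJ ->] /imfsetP[y yJ ->] /= /inj2 ->.
have inj2' : {in [fset (x.2, x.1) | x in J]%fset &, injective (fun x : word * word => x.2)}.
  by move=> _ _ /imfsetP[x xJ ->] /imfsetP[y yJ ->] /= /inj1 ->.
split=> //.
- split; rewrite big_imfset//= big_imfset//=.
    by rewrite -sum2 big_imfset.
  by rewrite -sum1 big_imfset.
- by move=> _ _ /imfsetP[x xJ ->] /imfsetP[y yJ ->] /=; rewrite J_lt.
by rewrite big_imfset//= fE star_table.
Qed.

(** These are the finite sums of mutually orthogonal [Pw], that is, the indicator functions of
    clopen subsets of Cantor space. *)
Definition locally_diagonal (q : A) : Prop :=
  exists N, forall w, (N <= size w)%N ->
    exists b : bool, q * Sw S w = Sw S w *+ b.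

Lemma locally_diagonal1 : locally_diagonal 1.
Proof. by exists 0%N => w _; exists true; rewrite mul1r. Qed.

Lemma mul_compl_Sw q w (b : bool) :
  q * Sw S w = Sw S w *+ b -> (1 - q) * Sw S w = Sw S w *+ ~~ b.
Proof. by move=> e; rewrite mulrBl mul1r e; case: b {e}; rewrite ?subrr ?subr0. Qed.

Lemma locally_diagonalC q : locally_diagonal q -> locally_diagonal (1 - q).
Proof.
by move=> [N qN]; exists N => w /qN[b e]; exists (~~ b); exact: mul_compl_Sw.
Qed.

Lemma locally_diagonal_act f q : thompsonF S f ->
  locally_diagonal q -> locally_diagonal (act S f q).
Proof.
move=> /(thompson_implements hS)[N [tau [_ tau_size _ tau_act]]] [M qM].
exists (N + M)%N => w le_w; have le_w' := leq_trans (leq_addr _ _) le_w.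
have [|b e] := qM (tau w).
  by rewrite -(leq_add2r N) addnC (leq_trans le_w)// tau_size.
by eexists; exact: tau_act e.
Qed.

(** On long words the word map of [f * g] is [ups \o tau], and the two changes of parity add up
    modulo 2. *)
Lemma actM f g q : thompsonF S f -> thompsonF S g -> locally_diagonal q ->
  act S (f * g) q = act S f (act S g q).
Proof.
move=> Ff Fg [K qK].
have [N [tau [tauE tau_size _ tau_act]]] := thompson_implements hS Ff.
have [M [ups [upsE ups_size _ ups_act]]] := thompson_implements hS Fg.
have [L [rho [rhoE _ _ rho_act]]] := thompson_implements hS (thompsonM Ff Fg).
(* [tau] loses at most [N] letters and [ups] at most [M]; [K] letters then remain for [q], and [L]
   serves the product. *)
apply: (@eq_on_words _ _ _ hS (N + M + K + L)) => w wN.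
have wl : (N <= size w)%N by rewrite wN -!addnA leq_addr.
have wl' : (L <= size w)%N by rewrite wN leq_addl.
have tl : (M + K <= size (tau w))%N.
  rewrite -(leq_add2r N); apply: leq_trans (tau_size _ wl).
  by rewrite wN addnC addnA leq_addr.
have ul : (K <= size (ups (tau w)))%N.
  by rewrite -(leq_add2r M) addnC (leq_trans tl)// ups_size// (leq_trans _ tl)// leq_addr.
have tl' := leq_trans (leq_addr _ _) tl.
have rhoE' : rho w = ups (tau w).
  by apply: (Sw_inj hS); rewrite -rhoE// -upsE// -tauE// starMr mulrA.
have [b e] := qK _ ul.
rewrite (rho_act _ _ b)// ?rhoE'// (tau_act _ _ _ wl (ups_act _ _ _ tl' e)).
congr (_ *+ nat_of_bool _).
by case: b {e}; do 3 case: odd.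
Qed.

(** The presentation chosen for [1] need not be the trivial one, but injectivity of [Sw] forces
    [tau w = w] on long words. *)
Lemma act_id q : locally_diagonal q -> act S 1 q = q.
Proof.
have [N [tau [tauE _ _ tau_act]]] := thompson_implements hS thompson1.
move=> [M qM]; apply: (@eq_on_words _ _ _ hS (N + M)) => w wN.
have wl : (N <= size w)%N by rewrite wN leq_addr.
have tw : tau w = w by apply: (Sw_inj hS); rewrite -tauE// star1 mul1r.
have [|b e] := qM w; first by rewrite wN leq_addl.
by rewrite (tau_act _ _ b)// tw ?addbb ?addbF.
Qed.

(** Negating the bit of [q] negates the resulting bit. This lets one formula transform both
    coordinates of [embed]. *)
Lemma act_compl f q : thompsonF S f -> locally_diagonal q ->
  act S f (1 - q) = 1 - act S f q.
Proof.
move=> /(thompson_implements hS)[N [tau [_ tau_size _ tau_act]]] [M qM].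
apply: (@eq_on_words _ _ _ hS (N + M)) => w wN.
have wl : (N <= size w)%N by rewrite wN leq_addr.
have [|b e] := qM (tau w).
  by rewrite -(leq_add2r N) (leq_trans _ (tau_size _ wl))// wN addnC.
rewrite (tau_act _ _ _ wl (mul_compl_Sw e)) (mul_compl_Sw (tau_act _ _ _ wl e)).
by rewrite addNb.
Qed.

(** At [q = 1] the odd summand of [act] vanishes. Seeing [Omega2] as an orbit reduces its stability
    to [actM]. *)
Lemma Omega2E q : Omega2 S q <-> exists2 f, thompsonF S f & q = act S f 1.
Proof.
have actE f : act S f 1 = part0 S f * star (part0 S f).
  by rewrite /act subrr mulr0 mul0r addr0 mulr1.
by split=> -[f Ff e]; exists f => //; rewrite ?e ?actE.
Qed.

Lemma Omega2_locally_diagonal q : Omega2 S q -> locally_diagonal q.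
Proof.
move=> /Omega2E[f Ff ->]; apply: locally_diagonal_act => //; exact: locally_diagonal1.
Qed.

Lemma Omega2_act f q : thompsonF S f -> Omega2 S q -> Omega2 S (act S f q).
Proof.
move=> Ff /Omega2E[g Fg ->]; apply/Omega2E; exists (f * g); first exact: thompsonM.
by rewrite actM//; exact: locally_diagonal1.
Qed.

(** Kraft's equality, by counting in two ways the pairs of a word [a] in [s] and a word of length
    [M] with prefix [a]. *)
Lemma sum_expn_partition (s : seq word) M :
  \sum_(a <- s) Pw S a = 1 -> {in s, forall a : word, (size a <= M)%N} ->
  (\sum_(a <- s) 2 ^ (M - size a) = 2 ^ M)%N.
Proof.
move=> sum1 s_le; rewrite -(size_words M) -sum1_size big_seq.
under eq_bigr => a /s_le le_a do rewrite -count_prefix_words// -sum1_count big_mkcond /=.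
rewrite -big_seq exchange_big /= [in RHS]big_seq big_seq; apply: eq_bigr => w.
rewrite mem_words => /eqP wM; rewrite -big_mkcond sum1_count.
by apply: (count_prefix_partition hS (v := id)) => // a /s_le; rewrite wM.
Qed.

(* If [act S f 1 = 0], then [size mu] and [size (tau mu)] have opposite parities
   for every long [mu]; summing the measures [2 ^ - size] modulo [3], where
   [2 = -1], then gives [1 = -1]. *)
Lemma Omega2_neq0 q : Omega2 S q -> q != 0.
Proof.
move=> /Omega2E[f Ff ->]; apply/eqP => e0.
have [N [tau [tauE _ _ tau_act]]] := thompson_implements hS Ff.
have [[fVf ffV] _] := Ff.
(* Were the parities equal, [act S f 1] would fix the nonzero [S_w]. *)
have tau_odd w : size w = N -> odd (size (tau w)) = ~~ odd N.
  move=> wN; have := tau_act w 1 true; rewrite wN mul1r => /(_ (leqnn _) erefl).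
  rewrite e0 mul0r; case: (odd N); case: odd => //= /esym/eqP;
    by rewrite mulr1n (negPf (Sw_neq0 hS _)).
pose s := map tau (words N); pose M := (\max_(a <- s) size a)%N.
have leM : {in s, forall a : word, (size a <= M)%N}.
  by move=> a sa; exact: (@leq_bigmax_seq _ _ xpredT (fun a : word => size a)).
have sum1 : \sum_(a <- s) Pw S a = 1.
  rewrite big_map; transitivity (star f * (\sum_(w <- words N) Pw S w) * f).
    rewrite mulr_sumr mulr_suml !big_seq; apply: eq_bigr => w.
    rewrite mem_words => /eqP wN; rewrite /Pw -tauE ?wN// starMr starK !mulrA.
    by [].
  by rewrite (sum_Pw_words hS [::] N) /Pw Sw_nil star1 !mulr1.
have := sum_expn_partition sum1 leM.
have F3 k : (2 ^ k)%N%:R = (-1) ^+ odd k :> 'F_3.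
  by rewrite natrX signr_odd; congr (_ ^+ _); exact/val_inj.
move=> /(congr1 (fun n : nat => n%:R : 'F_3)); rewrite natr_sum F3.
under eq_bigr do rewrite F3.
rewrite big_map big_seq.
under eq_bigr => w wN.
  rewrite oddB; last by apply: leM; exact: map_f.
  rewrite tau_odd; last by apply/eqP; rewrite -mem_words.
  over.
(* Each of the [2 ^ N] terms is [(-1) ^ (M + N + 1)], and [2 ^ N = (-1) ^ N] modulo 3, so the sum is
   [(-1) ^ (M + 1)] instead of [(-1) ^ M]. *)
rewrite -big_seq big_const_seq count_predT size_words iter_addr_0 -mulr_natr F3.
by case: (odd N); case: (odd M).
Qed.

(** [N] and [tau] are fixed before [q], so the right-hand side makes sense for arbitrary pairs of
    trees; the depth at which [q] becomes diagonal enters only the proof. *)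
Lemma tree_of_act f : thompsonF S f -> exists N (tau : word -> word),
  forall q a, locally_diagonal q ->
  Defs.tree_of S (act S f q) a =
  has (fun w => Defs.tree_of S
         (if odd (size (a ++ w)) (+) odd (size (tau (a ++ w))) then 1 - q else q)
         (tau (a ++ w))) (words (N - size a)).
Proof.
move=> /(thompson_implements hS)[N [tau [tauE tau_size _ tau_act]]].
exists N, tau => q a [M qM]; rewrite (tree_of_words hS _ _ (N - size a)).
apply: eq_in_has => w; rewrite mem_words => /eqP wN.
have : (N <= size (a ++ w))%N by rewrite size_cat wN -leq_subLR.
move: (a ++ w) => mu muN.
(* Appending letters commutes with [tau] beyond depth [N], so one can descend to the depth of [q]
   without altering the parity change. *)
have tau_cat c : tau (mu ++ c) = tau mu ++ c.
  apply: (Sw_inj hS); rewrite -tauE ?size_cat ?(leq_trans muN) ?leq_addr//.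
  by rewrite !Sw_cat mulrA tauE.
rewrite -Pw_eq0// -/(Defs.tree_of S _ mu) !(tree_of_words hS _ _ M).
apply: eq_in_has => c; rewrite mem_words => /eqP cM.
have [|b e] := qM (tau mu ++ c); first by rewrite size_cat cM leq_addl.
have e' : q * Sw S (tau (mu ++ c)) = Sw S (tau (mu ++ c)) *+ b by rewrite tau_cat.
rewrite (tau_act _ _ _ _ e') ?size_cat ?(leq_trans muN) ?leq_addr//.
rewrite tau_cat size_cat !oddD.
have -> : (odd (size mu) (+) odd (size c)) (+) (odd (size (tau mu)) (+) odd (size c)) =
   odd (size mu) (+) odd (size (tau mu)) by do 3 case: odd.
case: (odd (size mu) (+) odd (size (tau mu))).
  rewrite (mul_compl_Sw e) addbT; case: (~~ b) => //=.
  by rewrite !mulr1n !(negPf (Sw_neq0 hS _)).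
by rewrite e addbF; case: (b) => //=; rewrite !mulr1n !(negPf (Sw_neq0 hS _)).
Qed.

End ThompsonGroupAction.

(** * The product topology on pairs of vertex sets *)

Section VerticesTopology.
Implicit Types x : vertices * vertices.

Lemma near_vertices x a :
  \forall y \near x, y.1 a = x.1 a /\ y.2 a = x.2 a.
Proof.
have near_eval (t : vertices) : \forall u \near t, u a = t a.
  exact: (@proj_continuous _ (fun=> bool) a t _ (discrete_set1 (t a))).
apply: filterI.
  exact: (@cvg_fst _ _ (nbhs x.1) (nbhs x.2) _ _ (near_eval x.1)).
exact: (@cvg_snd _ _ (nbhs x.1) (nbhs x.2) _ _ (near_eval x.2)).
Qed.

Lemma near_vertices_seq x (l : seq word) :
  \forall y \near x, {in l, forall a, y.1 a = x.1 a /\ y.2 a = x.2 a}.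
Proof.
elim: l => [|a l IH]; first by apply: (@filterE _ (nbhs x) (nbhs_filter x)) => y a; rewrite in_nil.
have := near_vertices x a; apply: filterS2 IH => y IH ya b.
by rewrite inE => /orP[/eqP -> //|]; exact: IH.
Qed.

(** The topology is generated by evaluations in the discrete space [bool], so local constancy of
    each coordinate suffices. *)
Lemma continuous_vertices (X : topologicalType) (g : X -> vertices * vertices) :
  (forall z a, \forall y \near z, (g y).1 a = (g z).1 a /\ (g y).2 a = (g z).2 a) ->
  continuous g.
Proof.
move=> gP z.
have -> : g = (fun y => ((g y).1, (g y).2)) by apply/funext => y; case: (g y).
apply: (@cvg_pair _ _ _ _ (nbhs (g z).1) (nbhs (g z).2)).
  apply/cvg_sup => a U [_ [[W oW <-] Wa sub]].
  by apply: filterS (gP z a) => y [e _]; apply: sub; rewrite /preimage /= e.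
apply/cvg_sup => a U [_ [[W oW <-] Wa sub]].
by apply: filterS (gP z a) => y [_ e]; apply: sub; rewrite /preimage /= e.
Qed.

(** Used to pass conditions on finitely many vertices to the closure. *)
Lemma closure_vertices (B : set (vertices * vertices)) x (l : seq word) :
  closure B x -> exists2 y, B y & {in l, forall a, y.1 a = x.1 a /\ y.2 a = x.2 a}.
Proof. by move=> /(_ _ (near_vertices_seq x l))[y [By yl]]; exists y. Qed.

End VerticesTopology.

(** * The closure of [Omega2] and the extension of the action *)

Section Extension.
Context {R : realType} {A : cstarAlgType R} (S : bool -> A).
Hypothesis hS : cuntz2 S.

Lemma tree_of_root q : q != 0 -> Defs.tree_of S q [::].
Proof. by rewrite /Defs.tree_of /Pw Sw_nil star1 !mulr1. Qed.

Lemma tree_of_parent q a i : Defs.tree_of S q (rcons a i) -> Defs.tree_of S q a.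
Proof.
by rewrite -cats1; apply: contraNN => /eqP /(Pw_cat_eq0 hS) ->.
Qed.

Lemma tree_of_leafless q a : Defs.tree_of S q a -> exists i, Defs.tree_of S q (rcons a i).
Proof.
rewrite (tree_of_words hS _ _ 1) => /hasP[w]; rewrite mem_words.
case: w => [|i []]// _; rewrite -Pw_eq0// cats1 => qa; by exists i.
Qed.

(** Each tree axiom concerns at most three vertices, so it passes to limits; the first tree keeps
    its root because no member of [Omega2] is zero. *)
Lemma closure_Sigma2 : closure (embed S @` Omega2 S) `<=` Sigma2 `*` Sigma2s.
Proof.
move=> x cl; have approx l := closure_vertices l cl.
have root1 : x.1 [::].
  have [_ [q Oq <-] /(_ [::] (mem_head _ _))[<- _]] := approx [:: [::]].
  exact/tree_of_root/(Omega2_neq0 hS).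
have parent a i : (x.1 (rcons a i) -> x.1 a) /\ (x.2 (rcons a i) -> x.2 a).
  have [_ [q Oq <-] e] := approx [:: a; rcons a i].
  have [<- <-] := e a (mem_head _ _).
  have [<- <-] : _ /\ _ := e (rcons a i) ltac:(by rewrite !inE eqxx orbT).
  by split; exact: tree_of_parent.
have leaf a : (x.1 a -> exists i, x.1 (rcons a i)) /\ (x.2 a -> exists i, x.2 (rcons a i)).
  have [_ [q Oq <-] e] := approx [:: a; rcons a false; rcons a true].
  have [<- <-] := e a (mem_head _ _).
  have ei i : rcons a i \in [:: a; rcons a false; rcons a true].
    by rewrite !inE; case: i; rewrite eqxx !orbT.
  split=> [/(tree_of_leafless (q := q))|/(tree_of_leafless (q := 1 - q))] [i qi];
    by exists i; have [e1 e2] := e _ (ei i); rewrite -?e1 -?e2.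
split; first by split=> [|a /(leaf a).1//]; split=> // a i /(parent a i).1.
(* The second tree may lack the root; being closed under parents, it is then empty. *)
have [x2|x2] := boolP (x.2 [::]).
  by left; split=> [|a /(leaf a).2//]; split=> // a i /(parent a i).2.
right; apply/funext => a; apply: contraNF x2.
by elim/last_ind: a => // a i IH /(parent a i).2.
Qed.

Lemma Omega2_closureE : Omega2_closure S = closure (embed S @` Omega2 S).
Proof.
by apply/seteqP; split=> [x []//|x cl]; split=> //; exact: closure_Sigma2.
Qed.

Lemma embed_closure q : Omega2 S q -> Omega2_closure S (embed S q).
Proof.
by move=> Oq; rewrite Omega2_closureE; apply: subset_closure; exists q.
Qed.

Lemma embed_act f : thompsonF S f ->
  exists2 Phi : vertices * vertices -> vertices * vertices, continuous Phi &
    forall q, Omega2 S q -> Phi (embed S q) = embed S (act S f q).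
Proof.
move=> Ff; have [N [tau tauP]] := tree_of_act hS Ff.
pose nu a : seq word := [seq tau (a ++ w) | w <- words (N - size a)].
pose par (mu : word) := odd (size mu) (+) odd (size (tau mu)).
(* The formula of [tree_of_act] with [x.1] and [x.2] in place of the trees of [q] and [1 - q].
   Coordinate [a] reads only the finite list [nu a], whence continuity. *)
pose Phi (x : vertices * vertices) : vertices * vertices :=
  ((fun a => has (fun w => if par (a ++ w) then x.2 (tau (a ++ w)) else x.1 (tau (a ++ w)))
       (words (N - size a))),
   (fun a => has (fun w => if par (a ++ w) then x.1 (tau (a ++ w)) else x.2 (tau (a ++ w)))
       (words (N - size a)))).
exists Phi.
  apply: continuous_vertices => x a.
  apply: filterS (near_vertices_seq x (nu a)) => y yP.
  split; apply: eq_in_has => w wN;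
    by have [e1 e2] := yP _ (map_f (fun w => tau (a ++ w)) wN); rewrite e1 e2.
move=> q /(Omega2_locally_diagonal hS) dq; rewrite /embed -(act_compl hS)//.
congr pair; apply/funext => a; rewrite tauP//; last exact: locally_diagonalC.
  by apply: eq_has => w; rewrite /par; case: ifP.
by apply: eq_has => w; rewrite /par; case: ifP => // _; rewrite subKr.
Qed.

Lemma act_extension (f : thompsonF S) :
  exists g : Omega2_closure S -> Omega2_closure S, continuous g /\
    forall q x, Omega2 S q -> \val x = embed S q -> \val (g x) = embed S (act S (\val f) q).
Proof.
have Ff := set_valP f; have [Phi Phi_cont PhiE] := embed_act Ff.
have PhiO x : Omega2_closure S x -> Omega2_closure S (Phi x).
  rewrite Omega2_closureE => cl U /Phi_cont /cl[_ [[q Oq <-] UPhi]].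
  exists (Phi (embed S q)); split=> //; rewrite PhiE//; exists (act S (\val f) q) => //.
  exact: Omega2_act.
exists (fun x => SigSub (mem_set (PhiO _ (set_valP x)))); split.
  apply: continuous_comp_initial => x.
  apply: (@continuous_comp _ _ _ set_val Phi); last exact: Phi_cont.
  exact: initial_continuous.
by move=> q x Oq xq /=; rewrite xq PhiE.
Qed.

(** Near [x] both maps keep their coordinate [a], and by density an embedded element of [Omega2]
    lies there; coordinates separate points. *)
Lemma eq_on_Omega2 (g h : Omega2_closure S -> Omega2_closure S) :
  continuous g -> continuous h ->
  (forall q x, Omega2 S q -> \val x = embed S q -> g x = h x) -> g = h.
Proof.
move=> gc hc gh; apply/funext => x; apply/val_inj.
have val_near (k : Omega2_closure S -> Omega2_closure S) a : continuous k ->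
  \forall y \near x, (\val (k y)).1 a = (\val (k x)).1 a /\ (\val (k y)).2 a = (\val (k x)).2 a.
  by move=> kc; exact: (kc x _ (@initial_continuous _ _ set_val (k x) _ (near_vertices (\val (k x)) a))).
have key a : (\val (g x)).1 a = (\val (h x)).1 a /\ (\val (g x)).2 a = (\val (h x)).2 a.
  have [_ [[V oV <-] /= Vx VW]] := filterI (val_near g a gc) (val_near h a hc).
  have [/(_ V (open_nbhs_nbhs (conj oV Vx)))[_ [[q Oq <-] Vq]] _] := set_valP x.
  pose y : Omega2_closure S := SigSub (mem_set (embed_closure Oq)).
  have [[<- <-] [<- <-]] := VW y Vq.
  by rewrite (gh q y).
case: (\val (g x)) (\val (h x)) key => g1 g2 [h1 h2] /= key.
by congr pair; apply/funext => a; case: (key a).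
Qed.

End Extension.

Theorem mainTheorem3 (R : realType) (A : cstarAlgType R) (S : bool -> A)
    (hS : cuntz2 S) :
  exists! phi : thompsonF S -> Omega2_closure S -> Omega2_closure S,
    [/\ is_action phi,
        forall f, homeomorphism (phi f)
      & extends_act phi].
Proof.
have [phi phiP] := choice (act_extension hS).
have phi_cont f : continuous (phi f) by case: (phiP f).
have phiE f q x : Omega2 S q -> \val x = embed S q -> \val (phi f x) = embed S (act S (\val f) q).
  by case: (phiP f) => _; apply.
(* The action laws hold on the embedded [Omega2] by [act_id] and [actM], and extend by density. *)
have phi1 (e : thompsonF S) : \val e = 1 -> phi e = id.
  move=> e1; apply: (eq_on_Omega2 hS) => // [x|q x Oq xq]; first exact: cvg_id.
  apply/val_inj; rewrite /= (phiE _ q)// e1 act_id//; exact: Omega2_locally_diagonal.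
have phiM (f g h : thompsonF S) : \val h = \val f * \val g -> phi h = phi f \o phi g.
  move=> hfg; apply: (eq_on_Omega2 hS) => // [x|q x Oq xq].
    by apply: continuous_comp; exact: phi_cont.
  apply/val_inj; rewrite /= (phiE _ q)// hfg actM//; try exact: set_valP.
    rewrite (phiE f (act S (\val g) q))//; last exact: phiE.
    by apply: Omega2_act => //; exact: set_valP.
  exact: Omega2_locally_diagonal.
exists phi; split.
  split=> [|f|f q x]; last exact: phiE.
  - by split=> [e x /phi1 ->|f g h x /phiM ->].
  split=> //; have Ff := set_valP f.
  (* The inverse of [phi f] is the extension attached to [star f], which is continuous as well. *)
  pose fV : thompsonF S := SigSub (mem_set (thompson_star Ff)).
  pose e : thompsonF S := SigSub (mem_set (thompson1 hS)).
  have [[fVf ffV] _] := Ff.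
  exists (phi fV); split=> // x.
    by rewrite -[LHS]/((phi fV \o phi f) x) -(phiM fV f e)// phi1.
  by rewrite -[LHS]/((phi f \o phi fV) x) -(phiM f fV e)// phi1.
move=> psi [_ psi_homeo psi_ext]; apply/funext => f.
apply: (eq_on_Omega2 hS) => //; first by case: (psi_homeo f).
move=> q x Oq xq; apply/val_inj; rewrite (phiE _ q)//.
by rewrite (psi_ext f q).
Qed.
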